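(* Every piecewise polynomial function $f:\mathbb{R}^n\to\mathbb{R}$ is both the optimistic and the pessimistic value function of a polynomial bilevel problem whose lower-level objective is convex in the lower-level variable and whose lower-level feasible set is an (unbounded) box. More precisely, $$\mathcal{PP}\subseteq\mathcal{C}^{\mathrm{optim}}_{\mathrm{unbound}}\subseteq\mathcal{SA},\qquad \mathcal{PP}\subseteq\mathcal{C}^{\mathrm{pessim}}_{\mathrm{unbound}}\subseteq\mathcal{SA}.$$
   Context: Bilevel data: polynomials $P,Q:\mathbb{R}^n\times\mathbb{R}^m\to\mathbb{R}$ and a box $\mathcal{Y}=[a_1,b_1]\times\cdots\times[a_m,b_m]$, $a_i,b_i\in\mathbb{R}\cup\{\pm\infty\}$, unbounded if some $a_i=-\infty$ or $b_i=+\infty$. $\Theta(x):=\arg\min_{y\in\mathcal{Y}}Q(x,y)$; $\varphi_o(x)=\inf_{y\in\Theta(x)}P(x,y)$, $\varphi_p(x)=\sup_{y\in\Theta(x)}P(x,y)$, with $\varphi_o=+\infty$, $\varphi_p=-\infty$ when $\Theta(x)=\emptyset$. $\mathcal{C}^{\mathrm{optim}}_{\mathrm{unbound}}$ (resp. $\mathcal{C}^{\mathrm{pessim}}_{\mathrm{unbound}}$) is the set of functions $h$ on $\mathbb{R}^n$ for which there exist $m$, polynomials $P,Q$ with $Q(x,\cdot)$ convex for every $x$, and an unbounded box $\mathcal{Y}$, with $\varphi_o=h$ (resp. $\varphi_p=h$). A function $f:\mathbb{R}^n\to\mathbb{R}$ is piecewise polynomial ($f\in\mathcal{PP}$) if there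 exist a partition of $\mathbb{R}^n$ into finitely many pairwise disjoint semi-algebraic sets $S_1,\dots,S_N$ and polynomials $P_1,\dots,P_N$ with $f(x)=P_i(x)$ for $x\in S_i$. Semi-algebraic sets are finite unions of sets $\{x\mid P(x)=0,\ Q_j(x)>0,\ j\in J\}$ ($J$ finite, polynomials $P,Q_j$). $\mathcal{SA}$: extended-real-valued semi-algebraic functions (the sets where $f$ is finite, $+\infty$, $-\infty$ are semi-algebraic and the restriction of $f$ to where it is finite has semi-algebraic graph). *)

(* Defs.v *)
From HB Require Import structures.
From mathcomp Require Import all_boot all_order all_algebra.
(* The notations of [mpoly] clash with those of the analysis library. *)
From mathcomp Require Import -(notations) mpoly.
From mathcomp Require Import boolp classical_sets reals interval_inference.
From mathcomp Require Import constructive_ereal ereal convex.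

Set Implicit Arguments.
Unset Strict Implicit.
Unset Printing Implicit Defensive.

Import Order.TTheory GRing.Theory Num.Theory.

Local Open Scope classical_set_scope.
Local Open Scope ring_scope.

Definition polyval (R : realType) (n : nat) (p : mpoly n R)
    (x : 'rV[R]_n) : R :=
  meval (fun i => x ord0 i) p.

(* A polynomial on R^n x R^m is a polynomial in n + m variables, the first n of
   which are the coordinates of x. *)
Definition polyval2 (R : realType) (n m : nat) (p : mpoly (n + m) R)
    (x : 'rV[R]_n) (y : 'rV[R]_m) : R :=
  polyval p (row_mx x y).

Definition basic_semialgebraic (R : realType) (n : nat)
    (c : mpoly n R * seq (mpoly n R)) : set 'rV[R]_n :=
  [set x | polyval c.1 x = 0 /\ forall q, q \in c.2 -> 0 < polyval q x].

Definition semialgebraic (R : realType) (n : nat) (A : set 'rV[R]_n) : Prop :=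
  exists cs : seq (mpoly n R * seq (mpoly n R)),
    A = \bigcup_(c in [set` cs]) basic_semialgebraic c.

Definition piecewise_polynomial (R : realType) (n : nat)
    (f : 'rV[R]_n -> R) : Prop :=
  exists (N : nat) (S : 'I_N -> set 'rV[R]_n) (p : 'I_N -> mpoly n R),
    [/\ forall i, semialgebraic (S i),
        trivIset setT S,
        \bigcup_i S i = setT
      & forall i x, S i x -> f x = polyval (p i) x].

(* Real-valued functions are viewed as extended-real-valued ones. *)
Definition PP (R : realType) (n : nat) : set ('rV[R]_n -> \bar R) :=
  [set h | exists2 f : 'rV[R]_n -> R,
             piecewise_polynomial f & h = fun x => (f x)%:E].

(* The graph of the restriction of f to its finiteness domain, in R^(n+1). *)
Definition finite_graph (R : realType) (n : nat) (f : 'rV[R]_n -> \bar R) :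
    set 'rV[R]_(n + 1) :=
  [set z | f (lsubmx z) = (rsubmx z ord0 ord0)%:E].

Definition SA (R : realType) (n : nat) : set ('rV[R]_n -> \bar R) :=
  [set f | [/\ semialgebraic [set x | f x \is a fin_num],
               semialgebraic [set x | f x = +oo%E],
               semialgebraic [set x | f x = -oo%E]
             & semialgebraic (finite_graph f)]].

(* Infinite bounds are allowed: the box always consists of points of R^m. *)
Definition box (R : realType) (m : nat) (a b : 'I_m -> \bar R) :
    set 'rV[R]_m :=
  [set y | forall i, (a i <= (y ord0 i)%:E <= b i)%E].

Definition unbounded_box (R : realType) (m : nat) (a b : 'I_m -> \bar R) :
    Prop :=
  exists i, a i = -oo%E \/ b i = +oo%E.

Definition argmin_on (R : realType) (T : Type) (Y : set T) (g : T -> R) :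
    set T :=
  [set y | Y y /\ forall y', Y y' -> g y <= g y'].

Definition Theta (R : realType) (n m : nat) (Q : mpoly (n + m) R)
    (Y : set 'rV[R]_m) (x : 'rV[R]_n) : set 'rV[R]_m :=
  argmin_on Y (polyval2 Q x).

(* By [ereal_inf0] and [ereal_sup0], the values at a point x where Theta is
   empty are +oo and -oo respectively. *)
Definition phi_o (R : realType) (n m : nat) (P Q : mpoly (n + m) R)
    (Y : set 'rV[R]_m) (x : 'rV[R]_n) : \bar R :=
  ereal_inf [set (polyval2 P x y)%:E | y in Theta Q Y x].

Definition phi_p (R : realType) (n m : nat) (P Q : mpoly (n + m) R)
    (Y : set 'rV[R]_m) (x : 'rV[R]_n) : \bar R :=
  ereal_sup [set (polyval2 P x y)%:E | y in Theta Q Y x].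

Definition convex_lower (R : realType) (n m : nat)
    (Q : mpoly (n + m) R) : Prop :=
  forall x : 'rV[R]_n, @convex_function R 'rV[R]_m setT (polyval2 Q x).

Definition C_optim_unbound (R : realType) (n : nat) :
    set ('rV[R]_n -> \bar R) :=
  [set h | exists (m : nat) (P Q : mpoly (n + m) R)
                  (a b : 'I_m -> \bar R),
     [/\ convex_lower Q, unbounded_box a b & phi_o P Q (box a b) = h]].

Definition C_pessim_unbound (R : realType) (n : nat) :
    set ('rV[R]_n -> \bar R) :=
  [set h | exists (m : nat) (P Q : mpoly (n + m) R)
                  (a b : 'I_m -> \bar R),
     [/\ convex_lower Q, unbounded_box a b & phi_p P Q (box a b) = h]].

Arguments PP R n : clear implicits.
Arguments SA R n : clear implicits.
Arguments C_optim_unbound R n : clear implicits.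
Arguments C_pessim_unbound R n : clear implicits.

(* Main.v *)
(** Value functions are semi-algebraic: the argmin relation and the strict
    sublevel relation [phi_o x < s] are first-order definable, so they are
    semi-algebraic by quantifier elimination over real closed fields, and so is
    every function with semi-algebraic strict sublevel relation.  The
    pessimistic case follows from [phi_p P Q = - phi_o (- P) Q].

    Conversely, minimizing [(1 - g(x) z)^2] over [z >= 0] is a convex problem
    all of whose solutions satisfy [g(x) z = 1] if [g(x) > 0] and [g(x) z = 0]
    otherwise.  Summing such terms over the polynomials [g_j] describing the
    pieces of [f], the products [g_j z_j] are the indicators of [g_j > 0] on the
    whole solution set, and [f] is a polynomial in [x] and these products.  As
    the upper-level objective is constant on the solution set, the optimistic
    and pessimistic values agree. *)

Require Import Defs.
From mathcomp Require Import all_boot all_order all_algebra.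
From mathcomp Require Import -(notations) mpoly.
From mathcomp Require Import ordered_qelim qe_rcf.
From mathcomp Require Import boolp classical_sets reals constructive_ereal.
From mathcomp Require Import interval_inference ereal convex.
From mathcomp Require Import ring lra.

Set Implicit Arguments.
Unset Strict Implicit.
Unset Printing Implicit Defensive.

Import Order.TTheory GRing.Theory Num.Theory.

Local Open Scope classical_set_scope.
Local Open Scope ring_scope.

(** * Polynomial functions *)

(** Polynomiality is stated as mere existence, so that the closure properties below chain without
    any polynomial being written out. *)
Definition polyfun (R : realType) (n : nat) (g : 'rV[R]_n -> R) : Prop :=
  exists p : mpoly n R, forall x, polyval p x = g x.

Section PolynomialFunctions.
Variables (R : realType) (n : nat).
Implicit Types (g h : 'rV[R]_n -> R) (p : mpoly n R).

Lemma polyfun_polyval p : polyfun (polyval p).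
Proof. by exists p. Qed.

Lemma polyfun_cst (c : R) : polyfun (fun _ : 'rV[R]_n => c).
Proof. by exists (mpolyC n c) => x; rewrite /polyval mevalC. Qed.

Lemma polyfun_coord (i : 'I_n) : polyfun (fun x : 'rV[R]_n => x ord0 i).
Proof. by exists (mpolyX R (mnm1 i)) => x; rewrite /polyval mevalXU. Qed.

Lemma polyfunD g h : polyfun g -> polyfun h -> polyfun (fun x => g x + h x).
Proof.
by move=> [p pE] [q qE]; exists (p + q) => x; rewrite /polyval mevalD -pE -qE.
Qed.

Lemma polyfunM g h : polyfun g -> polyfun h -> polyfun (fun x => g x * h x).
Proof.
by move=> [p pE] [q qE]; exists (p * q) => x; rewrite /polyval mevalM -pE -qE.
Qed.

Lemma polyfunN g : polyfun g -> polyfun (fun x => - g x).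
Proof. by move=> [p pE]; exists (- p) => x; rewrite /polyval mevalN -pE. Qed.

Lemma polyfunB g h : polyfun g -> polyfun h -> polyfun (fun x => g x - h x).
Proof. by move=> gP hP; apply: polyfunD => //; apply: polyfunN. Qed.

Lemma polyfunX k g : polyfun g -> polyfun (fun x => g x ^+ k).
Proof.
by move=> [p pE]; exists (p ^+ k) => x; rewrite /polyval rmorphXn -pE.
Qed.

Lemma polyfun_sum I (r : seq I) (g : I -> 'rV[R]_n -> R) :
  (forall i, polyfun (g i)) -> polyfun (fun x => \sum_(i <- r) g i x).
Proof.
move=> gP; elim: r => [|i r [p pE]].
  by exists 0 => x; rewrite big_nil /polyval meval0.
have [q qE] := gP i; exists (q + p) => x.
by rewrite big_cons -pE -qE /polyval mevalD.
Qed.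

End PolynomialFunctions.

(** * Polynomial maps, for substitution of variables *)

Definition polymap (R : realType) (k n : nat)
    (F : 'rV[R]_k -> 'rV[R]_n) : Prop :=
  forall i, polyfun (fun x => F x ord0 i).

Section PolynomialMaps.
Variables (R : realType) (k n m : nat).

Lemma polymap_id : polymap (fun x : 'rV[R]_n => x).
Proof. by move=> i; apply: polyfun_coord. Qed.

Lemma polymap_coord (F : 'rV[R]_k -> 'rV[R]_n) (i : 'I_n) :
  polymap F -> polyfun (fun x => F x ord0 i).
Proof. exact. Qed.

Lemma polymapN (F : 'rV[R]_k -> 'rV[R]_n) :
  polymap F -> polymap (fun x => - F x).
Proof.
by move=> FP i; have [p pE] := polyfunN (FP i); exists p => x; rewrite pE mxE.
Qed.

Lemma polymap_lsubmx (F : 'rV[R]_k -> 'rV[R]_(n + m)) :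
  polymap F -> polymap (fun x => lsubmx (F x)).
Proof.
by move=> FP i; have [p pE] := FP (lshift m i); exists p => x; rewrite pE mxE.
Qed.

Lemma polymap_rsubmx (F : 'rV[R]_k -> 'rV[R]_(n + m)) :
  polymap F -> polymap (fun x => rsubmx (F x)).
Proof.
by move=> FP i; have [p pE] := FP (rshift n i); exists p => x; rewrite pE mxE.
Qed.

Lemma polymap_row_mx (F : 'rV[R]_k -> 'rV[R]_n) (G : 'rV[R]_k -> 'rV[R]_m) :
  polymap F -> polymap G -> polymap (fun x => row_mx (F x) (G x)).
Proof.
move=> FP GP i; rewrite -(splitK i); case: (split i) => j /=.
- by have [p pE] := FP j; exists p => x; rewrite row_mxEl pE.
- by have [p pE] := GP j; exists p => x; rewrite row_mxEr pE.
Qed.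

Lemma polyfun_comp (p : mpoly n R) (F : 'rV[R]_k -> 'rV[R]_n) :
  polymap F -> polyfun (fun x => polyval p (F x)).
Proof.
(* One polynomial is chosen for each coordinate of [F], and these are substituted for the variables
   of [p]. *)
move=> /choice[q qE]; exists (comp_mpoly [tuple q i | i < n] p) => x.
rewrite /polyval comp_mpoly_meval; apply: meval_eq => i.
by rewrite tnth_mktuple -qE.
Qed.

End PolynomialMaps.

Ltac solve_polymap := repeat first [exact: polymap_id | apply: polymapN
  | apply: polymap_lsubmx | apply: polymap_rsubmx | apply: polymap_row_mx].

Lemma polyfun_polyval2 (R : realType) (k n m : nat) (p : mpoly (n + m) R)
    (F : 'rV[R]_k -> 'rV[R]_n) (G : 'rV[R]_k -> 'rV[R]_m) :
  polymap F -> polymap G -> polyfun (fun x => polyval2 p (F x) (G x)).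
Proof. by move=> FP GP; apply/polyfun_comp/polymap_row_mx. Qed.

(** * Boolean operations on semi-algebraic sets *)

Section SemialgebraicSets.
Variables (R : realType) (n : nat).
Implicit Types (A B : set 'rV[R]_n) (g h : 'rV[R]_n -> R).

Lemma semialgebraicU A B :
  semialgebraic A -> semialgebraic B -> semialgebraic (A `|` B).
Proof.
move=> [cs ->] [ds ->]; exists (cs ++ ds); apply/seteqP; split=> x.
- by move=> [] [c /= cP xP]; exists c; rewrite //= mem_cat cP ?orbT.
- by move=> [c /=]; rewrite mem_cat => /orP[cP|cP] xP; [left|right]; exists c.
Qed.

Lemma semialgebraic_basic (c : mpoly n R * seq (mpoly n R)) :
  semialgebraic (basic_semialgebraic c).
Proof.
exists [:: c]; apply/seteqP; split=> x; first by exists c => //=; rewrite inE.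
by move=> [d /=]; rewrite inE => /eqP ->.
Qed.

(** A basic set has a single equation, so two equations are merged into the vanishing of the sum of
    their squares; unions are then distributed over the intersection. *)
Lemma semialgebraicI A B :
  semialgebraic A -> semialgebraic B -> semialgebraic (A `&` B).
Proof.
move=> [cs ->] [ds ->].
exists [seq (c.1 ^+ 2 + d.1 ^+ 2, c.2 ++ d.2) | c <- cs, d <- ds].
apply/seteqP; split=> x.
- move=> [[c /= cP [c1 c2]] [d /= dP [d1 d2]]].
  exists (c.1 ^+ 2 + d.1 ^+ 2, c.2 ++ d.2).
    by rewrite /=; apply/allpairsP; exists (c, d).
  split=> /=; last first.
    by move=> q; rewrite mem_cat => /orP[]; [apply: c2|apply: d2].
  move: c1 d1; rewrite /polyval mevalD !rmorphXn /= => -> ->.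
  by rewrite !expr0n addr0.
- move=> [e /= /allpairsP[[c d] /= [cP dP ->]] [/= + e2]].
  rewrite /polyval mevalD !rmorphXn /= => /eqP.
  rewrite paddr_eq0 ?sqr_ge0// !expf_eq0 /= => /andP[/eqP c1 /eqP d1].
  split; [exists c|exists d] => //; split=> // q qP; apply: e2.
  + by rewrite mem_cat qP.
  + by rewrite mem_cat qP orbT.
Qed.

Lemma semialgebraic_eq0 g : polyfun g -> semialgebraic [set x | g x = 0].
Proof.
move=> [p pE]; suff -> : [set x | g x = 0] = basic_semialgebraic (p, [::]).
  exact: semialgebraic_basic.
by apply/seteqP; split=> x; rewrite /= -pE; [split|case].
Qed.

Lemma semialgebraic_gt0 g : polyfun g -> semialgebraic [set x | 0 < g x].
Proof.
(* The zero polynomial supplies a vacuous equation. *)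
move=> [p pE]; suff -> : [set x | 0 < g x] = basic_semialgebraic (0, [:: p]).
  exact: semialgebraic_basic.
apply/seteqP; split=> x; rewrite /= -pE.
- move=> px; split=> [|q]; first exact: meval0.
  by rewrite inE => /eqP ->.
- by case=> _; apply; rewrite inE.
Qed.

Lemma semialgebraic_lt g h :
  polyfun g -> polyfun h -> semialgebraic [set x | g x < h x].
Proof.
move=> gP hP; under eq_set do rewrite -subr_gt0.
exact/semialgebraic_gt0/polyfunB.
Qed.

Lemma semialgebraic0 : semialgebraic (@set0 'rV[R]_n).
Proof. by exists [::]; rewrite bigcup0. Qed.

Lemma semialgebraicT : semialgebraic (@setT 'rV[R]_n).
Proof.
suff <- : [set x : 'rV[R]_n | 0 = 0 :> R] = setT.
  by apply: semialgebraic_eq0; apply: polyfun_cst.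
by apply/seteqP; split.
Qed.

Lemma semialgebraic_bigsetU I (r : seq I) (A : I -> set 'rV[R]_n) :
  (forall i, semialgebraic (A i)) ->
  semialgebraic (\big[setU/set0]_(i <- r) A i).
Proof.
move=> AP; elim/big_rec: _ => [|i B _]; first exact: semialgebraic0.
exact: semialgebraicU.
Qed.

Lemma semialgebraic_bigsetI I (r : seq I) (A : I -> set 'rV[R]_n) :
  (forall i, semialgebraic (A i)) ->
  semialgebraic (\big[setI/setT]_(i <- r) A i).
Proof.
move=> AP; elim/big_rec: _ => [|i B _]; first exact: semialgebraicT.
exact: semialgebraicI.
Qed.

Lemma semialgebraic_le g h :
  polyfun g -> polyfun h -> semialgebraic [set x | g x <= h x].
Proof.
move=> gP hP.
suff -> : [set x | g x <= h x] = [set x | g x < h x] `|` [set x | h x - g x = 0].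
  apply: semialgebraicU; first exact: semialgebraic_lt.
  exact/semialgebraic_eq0/polyfunB.
apply/seteqP; split=> x /=; last first.
  by move=> [/ltW//|/eqP]; rewrite subr_eq0 => /eqP ->.
by rewrite le_eqVlt => /orP[/eqP ->|]; [right; rewrite subrr|left].
Qed.

(** By De Morgan it is enough to complement a basic set: a point lies outside when its equation
    fails, which is strict positivity of a square, or when one of its finitely many strict
    inequalities is reversed. *)
Lemma semialgebraicC A : semialgebraic A -> semialgebraic (~` A).
Proof.
move=> [cs ->]; rewrite setC_bigcup bigcap_seq.
apply: semialgebraic_bigsetI => c.
suff -> : ~` basic_semialgebraic c =
    [set x | 0 < polyval c.1 x ^+ 2] `|`
    \big[setU/set0]_(q <- c.2) [set x | polyval q x <= 0].
  apply: semialgebraicU.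
    exact/semialgebraic_gt0/polyfunX/polyfun_polyval.
  apply: semialgebraic_bigsetU => q; apply: semialgebraic_le.
  - exact: polyfun_polyval.
  - exact: polyfun_cst.
rewrite -bigcup_seq; apply/seteqP; split=> x /=.
- move=> ncx; rewrite exprn_even_gt0//=.
  have [c1|] := eqVneq (polyval c.1 x) 0; last by left.
  right; apply: contrapT => nx; apply: ncx; split=> // q qc.
  by rewrite ltNge; apply/negP => qx; apply: nx; exists q.
- move=> [+ [c1 _]|[q /= qc qx] [_ /(_ q qc)]].
    by rewrite c1 expr0n ltxx.
  by rewrite ltNge qx.
Qed.

Lemma semialgebraic_not (P : 'rV[R]_n -> Prop) :
  semialgebraic [set x | P x] -> semialgebraic [set x | ~ P x].
Proof. exact: semialgebraicC. Qed.

Lemma semialgebraic_iff (P Q : 'rV[R]_n -> Prop) :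
  semialgebraic [set x | P x] -> semialgebraic [set x | Q x] ->
  semialgebraic [set x | P x <-> Q x].
Proof.
move=> AP BP; suff -> : [set x | P x <-> Q x] =
    ([set x | P x] `&` [set x | Q x]) `|` (~` [set x | P x] `&` ~` [set x | Q x]).
  by apply: semialgebraicU; apply: semialgebraicI => //; apply: semialgebraicC.
apply/seteqP; split=> x /=; last by tauto.
by move=> PQ; have [Px|nPx] := pselect (P x); [left|right]; tauto.
Qed.

End SemialgebraicSets.

Lemma semialgebraic_preimage (R : realType) (n k : nat) (A : set 'rV[R]_n)
    (F : 'rV[R]_k -> 'rV[R]_n) :
  semialgebraic A -> polymap F ->
  semialgebraic [set x | A (F x)].
Proof.
move=> [cs ->] FP.
suff -> : [set x | (\bigcup_(c in [set` cs]) basic_semialgebraic c) (F x)] =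
    \big[setU/set0]_(c <- cs) ([set x | polyval c.1 (F x) = 0] `&`
      \big[setI/setT]_(q <- c.2) [set x | 0 < polyval q (F x)]).
  apply: semialgebraic_bigsetU => c; apply: semialgebraicI.
    exact/semialgebraic_eq0/polyfun_comp.
  apply: semialgebraic_bigsetI => q.
  exact/semialgebraic_gt0/polyfun_comp.
rewrite -bigcup_seq; apply/seteqP; split=> x /=.
- by move=> [c cP [c1 c2]]; exists c => //; split=> //; rewrite -bigcap_seq.
- move=> [c cP [/= c1 +]]; rewrite -bigcap_seq => c2.
  by exists c => //; split=> // q /c2.
Qed.

(** * Projections of semi-algebraic sets *)

Section TarskiSeidenberg.
Variable R : realType.

(** The environment in which formulas are evaluated: variable [i] stands for the coordinate [i] of
    [x]. *)
Definition rowseq (n : nat) (x : 'rV[R]_n) : seq R :=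
  [seq x ord0 i | i <- enum 'I_n].

Lemma size_rowseq n (x : 'rV[R]_n) : size (rowseq x) = n.
Proof. by rewrite size_map size_enum_ord. Qed.

Lemma nth_rowseq n (x : 'rV[R]_n) (i : 'I_n) : (rowseq x)`_i = x ord0 i.
Proof. by rewrite (nth_map i) ?size_enum_ord// nth_ord_enum. Qed.

Lemma rowseq_nth n (s : seq R) : size s = n -> rowseq (\row_(i < n) s`_i) = s.
Proof.
move=> sn; apply: (@eq_from_nth _ 0); rewrite size_rowseq// => i ltin.
by rewrite (nth_rowseq _ (Ordinal ltin)) mxE.
Qed.

Lemma rowseq_row_mx n m (x : 'rV[R]_n) (y : 'rV[R]_m) :
  rowseq (row_mx x y) = rowseq x ++ rowseq y.
Proof.
apply: (@eq_from_nth _ 0); first by rewrite size_cat !size_rowseq.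
move=> i; rewrite size_rowseq => ltin.
rewrite (nth_rowseq _ (Ordinal ltin)) nth_cat size_rowseq.
rewrite -(splitK (Ordinal ltin)).
have := splitK (Ordinal ltin); case: (split _) => j /= /(congr1 val) /= <-.
- by rewrite row_mxEl ltn_ord nth_rowseq.
- by rewrite row_mxEr ltnNge leq_addr/= addKn nth_rowseq.
Qed.

(** * Translation between polynomial conditions and first-order formulas *)

Lemma polyfun_eval n (t : GRing.term R) :
  GRing.rterm t -> polyfun (fun x : 'rV[R]_n => GRing.eval (rowseq x) t).
Proof.
elim: t => //=.
- move=> i _; have [ltin|leni] := ltnP i n.
    have [p pE] := polyfun_coord R (Ordinal ltin).
    by exists p => x; rewrite pE -nth_rowseq.
  (* Variables of index at least [n] read the default value 0 of the environment. *)
  by exists 0 => x; rewrite nth_default ?size_rowseq// /polyval meval0.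
- by move=> c _; apply: polyfun_cst.
- by move=> k _; apply: polyfun_cst.
- by move=> t1 IH1 t2 IH2 /andP[/IH1 ? /IH2 ?]; apply: polyfunD.
- by move=> t IH /IH; apply: polyfunN.
- move=> t IH k /IH [p pE]; exists (p *+ k) => x.
  by rewrite /polyval mevalMn -pE.
- by move=> t1 IH1 t2 IH2 /andP[/IH1 ? /IH2 ?]; apply: polyfunM.
- by move=> t IH k /IH; apply: polyfunX.
Qed.

Lemma term_of_polyfun n (g : 'rV[R]_n -> R) :
  polyfun g -> exists t, forall x, GRing.eval (rowseq x) t = g x.
Proof.
move=> [p pE].
suff [t tE] : exists t, forall x, GRing.eval (rowseq x) t = polyval p x.
  by exists t => x; rewrite tE.
(* The term is built along the expansion of [p] into monomials, each monomial being a product of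
   powers of variables. *)
rewrite (mpolyE p); elim/big_ind: _ => [|q r [t tE] [u uE]|m _].
- by exists (GRing.Const 0) => x; rewrite /polyval meval0.
- by exists (GRing.Add t u) => x; rewrite /polyval mevalD /= tE uE.
suff [t tE] : exists t, forall x : 'rV[R]_n,
    GRing.eval (rowseq x) t = \prod_(i < n) x ord0 i ^+ m i.
  exists (GRing.Mul (GRing.Const (mcoeff m p)) t) => x.
  by rewrite /polyval mevalZ mevalX /= tE.
elim: (index_enum _) => [|i r [t tE]].
  by exists (GRing.Const 1) => x; rewrite big_nil.
exists (GRing.Mul (GRing.Exp (GRing.Var R i) (m i)) t) => x /=.
by rewrite big_cons tE nth_rowseq.
Qed.

Lemma semialgebraic_holds n (f : ord.formula R) :
  ord.qf_form f -> ord.rformula f ->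
  semialgebraic [set x : 'rV[R]_n | ord.holds (rowseq x) f].
Proof.
elim: f => //=.
- move=> b _ _; have [bT|bF] := boolP b.
    suff -> : [set _ : 'rV[R]_n | true] = setT by exact: semialgebraicT.
    by apply/seteqP; split.
  suff -> : [set _ : 'rV[R]_n | false] = set0 by exact: semialgebraic0.
  by apply/seteqP; split.
- move=> t1 t2 _ /andP[/polyfun_eval t1P /polyfun_eval t2P].
  have -> : [set x : 'rV[R]_n | GRing.eval (rowseq x) t1 = GRing.eval (rowseq x) t2]
      = [set x | GRing.eval (rowseq x) t1 - GRing.eval (rowseq x) t2 = 0].
    apply/seteqP; split=> x /= [E]; first by rewrite E subrr.
    exact: subr0_eq E.
  exact/semialgebraic_eq0/polyfunB.
- by move=> t1 t2 _ /andP[? ?]; apply: semialgebraic_lt; apply: polyfun_eval.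
- by move=> t1 t2 _ /andP[? ?]; apply: semialgebraic_le; apply: polyfun_eval.
- move=> f1 IH1 f2 IH2 /andP[q1 q2] /andP[r1 r2].
  by apply: semialgebraicI; [apply: IH1|apply: IH2].
- move=> f1 IH1 f2 IH2 /andP[q1 q2] /andP[r1 r2].
  by apply: semialgebraicU; [apply: IH1|apply: IH2].
- move=> f1 IH1 f2 IH2 /andP[q1 q2] /andP[r1 r2].
  have -> : [set x : 'rV[R]_n | ord.holds (rowseq x) f1 -> ord.holds (rowseq x) f2]
      = ~` [set x | ord.holds (rowseq x) f1] `|` [set x | ord.holds (rowseq x) f2].
    apply/seteqP; split=> x /=; last by tauto.
    by move=> f12; have [/f12|] := pselect (ord.holds (rowseq x) f1); [right|left].
  by apply: semialgebraicU; [apply/semialgebraicC/IH1|apply: IH2].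
- by move=> f IH qf rf; apply/semialgebraicC/IH.
Qed.

Lemma semialgebraic_formula n (A : set 'rV[R]_n) : semialgebraic A ->
  exists f, forall x, ord.holds (rowseq x) f <-> A x.
Proof.
move=> [cs ->]; elim: cs => [|c cs [f fP]].
  by exists (ord.Bool false) => x; rewrite /= set_nil bigcup_set0.
have [t tE] := term_of_polyfun (polyfun_polyval c.1).
have [g gP] : exists g, forall x : 'rV[R]_n,
    ord.holds (rowseq x) g <-> forall q, q \in c.2 -> 0 < polyval q x.
  elim: c.2 => [|q s [g gP]]; first by exists (ord.Bool true).
  have [u uE] := term_of_polyfun (polyfun_polyval q).
  exists (ord.And (ord.Lt (GRing.Const 0) u) g) => x /=; rewrite uE; split.
    by move=> [q0 /gP sP] r; rewrite inE => /orP[/eqP ->//|/sP].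
  move=> sP; split; first by apply: sP; rewrite mem_head.
  by apply/gP => r rs; apply: sP; rewrite inE rs orbT.
exists (ord.Or (ord.And (ord.Equal t (GRing.Const 0)) g) f) => x /=.
rewrite tE; split=> [[[c1 /gP c2]|/fP[d /= dcs xd]]|[d /=]].
- by exists c => //=; rewrite mem_head.
- by exists d => //=; rewrite inE dcs orbT.
- rewrite inE => /orP[/eqP -> [c1 c2]|dcs xd]; first by left; split=> //; apply/gP.
  by right; apply/fP; exists d.
Qed.

(** Quantifying variable [k] overwrites entry [k] of the environment. When the environment has
    length exactly [k] this appends a value, so successive quantifiers append a block of [m]
    values. *)
Lemma holds_exists_iota (f : ord.formula R) k m (e : seq R) : size e = k ->
  ord.holds e (foldr ord.Exists f (iota k m)) <->
  exists2 s, size s = m & ord.holds (e ++ s) f.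
Proof.
elim: m k e => [|m IH] k e ek /=.
  split=> [fe|[s /size0nil ->]]; last by rewrite cats0.
  by exists [::]; rewrite ?cats0.
have szr (a : R) : size (rcons e a) = k.+1 by rewrite size_rcons ek.
have setE (a : R) : set_nth 0 e k a = rcons e a.
  by rewrite -ek set_nthE ltnn subnn cats1.
split=> [[a]|[[//|a s] /= [sm] fs]].
  rewrite setE => /(IH _ _ (szr a))[s sm]; rewrite cat_rcons.
  by exists (a :: s) => //=; rewrite sm.
by exists a; rewrite setE; apply/(IH _ _ (szr a)); exists s; rewrite ?cat_rcons.
Qed.

(** Tarski-Seidenberg: the set is turned into a formula, its last [m] variables are quantified, the
    quantifiers are eliminated, and the resulting formula is read back as a set. *)
Lemma semialgebraic_exists n m (P : 'rV[R]_n -> 'rV[R]_m -> Prop) :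
  semialgebraic [set z | P (lsubmx z) (rsubmx z)] ->
  semialgebraic [set x | exists y, P x y].
Proof.
move=> /semialgebraic_formula[f fP].
pose F := foldr ord.Exists f (iota n m).
(* [to_rform] removes ring inverses, so that the terms of [G] are polynomial. *)
pose G := ord.quantifier_elim (@wproj R) (ord.to_rform F).
have /andP[qfG rG] : ord.qf_form G && ord.rformula G.
  apply: ord.quantifier_elim_wf (ord.to_rform_rformula F).
  exact: wf_QE_wproj.
suff -> : [set x | exists y, P x y] = [set x : 'rV[R]_n | ord.holds (rowseq x) G].
  exact: semialgebraic_holds.
(* [rcf_sat] on [F] is by definition the evaluation of [G], so its correctness relates the two
   formulas. *)
have GE (x : 'rV[R]_n) : ord.holds (rowseq x) G <-> ord.holds (rowseq x) F.
  by split=> [/(ord.qf_evalP _ qfG)/rcf_satP//|/rcf_satP/(ord.qf_evalP _ qfG)].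
apply/seteqP; split=> x /= => [[y xy]|/GE].
  apply/GE/holds_exists_iota; first exact: size_rowseq.
  exists (rowseq y); rewrite ?size_rowseq// -rowseq_row_mx.
  by apply/fP; rewrite /= row_mxKl row_mxKr.
move=> /(holds_exists_iota _ _ (size_rowseq x))[s sm].
rewrite -(rowseq_nth sm) -rowseq_row_mx => /fP/=.
by rewrite row_mxKl row_mxKr => ?; exists (\row_i s`_i).
Qed.

Lemma semialgebraic_forall n m (P : 'rV[R]_n -> 'rV[R]_m -> Prop) :
  semialgebraic [set z | P (lsubmx z) (rsubmx z)] ->
  semialgebraic [set x | forall y, P x y].
Proof.
move=> /semialgebraicC/(@semialgebraic_exists _ _ (fun x y => ~ P x y)).
move=> /semialgebraicC; congr semialgebraic; apply/seteqP; split=> x /=.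
- by move=> nP y; apply: contrapT => nPy; apply: nP; exists y.
- by move=> Pxy [y].
Qed.

End TarskiSeidenberg.

(** * Value functions are semi-algebraic *)

Section ValueFunctionsAreSemialgebraic.
Variable R : realType.

Lemma semialgebraic_preimage2 n m k (P : 'rV[R]_n -> 'rV[R]_m -> Prop)
    (F : 'rV[R]_k -> 'rV[R]_n) (G : 'rV[R]_k -> 'rV[R]_m) :
  semialgebraic [set z | P (lsubmx z) (rsubmx z)] ->
  polymap F ->
  polymap G ->
  semialgebraic [set x | P (F x) (G x)].
Proof.
move=> /semialgebraic_preimage AP FP GP.
have := AP _ _ (polymap_row_mx FP GP); congr semialgebraic.
by apply/seteqP; split=> x; rewrite /= row_mxKl row_mxKr.
Qed.

(* A value of [h] is determined by the reals lying strictly above it. *)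
Lemma SA_of_sublevel n (h : 'rV[R]_n -> \bar R) :
  semialgebraic [set z : 'rV[R]_(n + 1) |
    (h (lsubmx z) < (rsubmx z ord0 ord0)%:E)%E] ->
  SA R n h.
Proof.
move=> hP.
have pinfP : semialgebraic [set x | h x = +oo%E].
  have -> : [set x | h x = +oo%E] =
      [set x | forall s : 'rV[R]_1, ~ (h x < (s ord0 ord0)%:E)%E].
    apply/seteqP; split=> x /= hx; first by move=> s; rewrite hx.
    case E : (h x) => [r| |] //.
    - by have := hx (const_mx (r + 1)); rewrite E mxE lte_fin ltrDl => /(_ ltr01).
    - by have := hx 0; rewrite E ltNyr.
  exact/semialgebraic_forall/semialgebraic_not.
have ninfP : semialgebraic [set x | h x = -oo%E].
  have -> : [set x | h x = -oo%E] =
      [set x | forall s : 'rV[R]_1, (h x < (s ord0 ord0)%:E)%E].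
    apply/seteqP; split=> x /= hx; first by move=> s; rewrite hx ltNyr.
    case E : (h x) => [r| |] //.
    - by have := hx (const_mx r); rewrite E mxE ltxx.
    - by have := hx 0; rewrite E.
  exact: semialgebraic_forall.
split=> //.
- have -> : [set x | h x \is a fin_num] =
      ~` ([set x | h x = +oo%E] `|` [set x | h x = -oo%E]).
    apply/seteqP; split=> x /=; case: (h x) => //; try tauto.
    by move=> r _ [].
  exact/semialgebraicC/semialgebraicU.
(* The value of [h] is the real t exactly when the same reals s lie strictly above both. *)
- have -> : finite_graph h = [set z | forall s : 'rV[R]_1,
      (h (lsubmx z) < (s ord0 ord0)%:E)%E <-> rsubmx z ord0 ord0 < s ord0 ord0].
    apply/seteqP; split=> z /=; rewrite /finite_graph/=.
      by move=> -> s; rewrite lte_fin.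
    move=> hz; apply/eqP; rewrite eq_le.
    (* If t were below the value of [h], the equivalence would fail at s equal to that value, or at
       s = t + 1 when the value is infinite. If t were above it, the equivalence would fail at s =
       t. *)
    apply/andP; split; rewrite leNgt; apply/negP.
    - case E : (h _) => [r| |] //; rewrite ?lte_fin => rs.
      + by have := hz (const_mx r); rewrite E mxE ltxx => -[_ /(_ rs)].
      + have := hz (const_mx (rsubmx z ord0 ord0 + 1)).
        by rewrite E mxE ltrDl => -[_ /(_ ltr01)].
    - case E : (h _) => [r| |] // rs.
      + have := hz (const_mx (rsubmx z ord0 ord0)).
        by rewrite E mxE ltxx => -[/(_ rs)].
      + have := hz (const_mx (rsubmx z ord0 ord0)).
        by rewrite E mxE ltxx => -[/(_ rs)].
  apply: semialgebraic_forall; apply: semialgebraic_iff.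
  + apply: (semialgebraic_preimage2
      (P := fun x (s : 'rV[R]_1) => (h x < (s ord0 ord0)%:E)%E)) hP _ _; solve_polymap.
  + by apply: semialgebraic_lt; apply: polymap_coord; solve_polymap.
Qed.

(** Negation exchanges the two infinite loci and reflects the graph in its last coordinate; this
    transfers the optimistic case to the pessimistic one. *)
Lemma SA_opp n (h : 'rV[R]_n -> \bar R) : SA R n h -> SA R n (fun x => - h x)%E.
Proof.
move=> [finP pinfP ninfP graphP]; split.
- by under eq_set do rewrite fin_numN.
- by congr semialgebraic: ninfP; apply/seteqP; split=> x /= E;
    [rewrite E|rewrite -[h x]oppeK E].
- by congr semialgebraic: pinfP; apply/seteqP; split=> x /= E;
    [rewrite E|rewrite -[h x]oppeK E].
- have -> : finite_graph (fun x => - h x)%E =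
      [set z | finite_graph h (row_mx (lsubmx z) (- rsubmx z))].
    apply/seteqP; split=> z;
      rewrite /finite_graph/= row_mxKl row_mxKr [(- rsubmx z) _ _]mxE EFinN.
      by move=> <-; rewrite oppeK.
    by move=> ->; rewrite oppeK.
  by apply: semialgebraic_preimage graphP _; solve_polymap.
Qed.

Lemma semialgebraic_box m (a b : 'I_m -> \bar R) : semialgebraic (box a b).
Proof.
have -> : box a b = \big[setI/setT]_(i < m)
    ([set y : 'rV[R]_m | (a i <= (y ord0 i)%:E)%E] `&`
     [set y : 'rV[R]_m | ((y ord0 i)%:E <= b i)%E]).
  rewrite -bigcap_seq; apply/seteqP; split=> y yab.
    by move=> i _; apply/andP/yab.
  by move=> i; apply/andP; apply: (yab i) => /=; rewrite mem_index_enum.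
apply: semialgebraic_bigsetI => i; apply: semialgebraicI.
- case: (a i) => [r| |].
  + by apply: semialgebraic_le; [apply: polyfun_cst|apply: polyfun_coord].
  + have -> : [set y : 'rV[R]_m | (+oo <= (y ord0 i)%:E)%E] = set0.
      by apply/seteqP; split.
    exact: semialgebraic0.
  + have -> : [set y : 'rV[R]_m | (-oo <= (y ord0 i)%:E)%E] = setT.
      by apply/seteqP; split=> y //= _; rewrite leNye.
    exact: semialgebraicT.
- case: (b i) => [r| |].
  + by apply: semialgebraic_le; [apply: polyfun_coord|apply: polyfun_cst].
  + have -> : [set y : 'rV[R]_m | ((y ord0 i)%:E <= +oo)%E] = setT.
      by apply/seteqP; split=> y //= _; rewrite leey.
    exact: semialgebraicT.
  + have -> : [set y : 'rV[R]_m | ((y ord0 i)%:E <= -oo)%E] = set0.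
      by apply/seteqP; split.
    exact: semialgebraic0.
Qed.

Lemma semialgebraic_Theta n m (Q : mpoly (n + m) R) (Y : set 'rV[R]_m) :
  semialgebraic Y ->
  semialgebraic [set z | Theta Q Y (lsubmx z) (rsubmx z)].
Proof.
move=> YP.
(* Minimality is recast as the absence of a feasible point with a strictly smaller value, which uses
   only negation, conjunction and a universal quantifier. *)
have -> : [set z | Theta Q Y (lsubmx z) (rsubmx z)] =
    [set z | Y (rsubmx z)] `&` [set z | forall y', ~ (Y y' /\
      polyval2 Q (lsubmx z) y' < polyval2 Q (lsubmx z) (rsubmx z))].
  apply/seteqP; split=> z [Yz zmin]; split=> // y'.
    by move=> [/zmin]; rewrite leNgt => /negP.
  by move=> Yy'; rewrite leNgt; apply/negP => lt; apply: (zmin y').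
apply: semialgebraicI.
  by apply: semialgebraic_preimage YP _; solve_polymap.
apply: semialgebraic_forall; apply: semialgebraic_not; apply: semialgebraicI.
  by apply: semialgebraic_preimage YP _; solve_polymap.
by apply: semialgebraic_lt; apply: polyfun_polyval2; solve_polymap.
Qed.

(** An infimum is strictly below s exactly when some element of the set is, whether or not it is
    attained. This also covers an empty [Theta], where both sides fail. *)
Lemma SA_phi_o n m (P Q : mpoly (n + m) R) (Y : set 'rV[R]_m) :
  semialgebraic Y -> SA R n (phi_o P Q Y).
Proof.
move=> YP; apply: SA_of_sublevel.
have -> : [set z : 'rV[R]_(n + 1) |
      (phi_o P Q Y (lsubmx z) < (rsubmx z ord0 ord0)%:E)%E] =
    [set z | exists y, Theta Q Y (lsubmx z) y /\
      polyval2 P (lsubmx z) y < rsubmx z ord0 ord0].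
  apply/seteqP; split=> z /=.
    by move=> /ereal_inf_lt[_ [y yP <-]]; rewrite lte_fin; exists y.
  move=> [y [yP Pz]]; apply: le_lt_trans (_ : (polyval2 P (lsubmx z) y)%:E < _)%E.
    by apply: ereal_inf_lbound; exists y.
  by rewrite lte_fin.
apply: semialgebraic_exists; apply: semialgebraicI.
- by apply: (semialgebraic_preimage2 (semialgebraic_Theta Q YP)); solve_polymap.
- by apply: semialgebraic_lt; [apply: polyfun_polyval2|apply: polymap_coord]; solve_polymap.
Qed.

Lemma phi_pE n m (P Q : mpoly (n + m) R) (Y : set 'rV[R]_m) x :
  phi_p P Q Y x = (- phi_o (- P)%R Q Y x)%E.
Proof.
rewrite /phi_o /ereal_inf oppeK; congr ereal_sup.
rewrite image_comp; apply: eq_imagel => y _ /=.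
by rewrite /polyval2 /polyval mevalN opprK.
Qed.

Lemma SA_phi_p n m (P Q : mpoly (n + m) R) (Y : set 'rV[R]_m) :
  semialgebraic Y -> SA R n (phi_p P Q Y).
Proof.
move=> /(SA_phi_o (- P) Q)/SA_opp; congr SA.
by apply: funext => x; rewrite phi_pE.
Qed.

End ValueFunctionsAreSemialgebraic.

(** * Piecewise polynomial functions are value functions *)

Section SignDetection.
Variables (R : realType) (n m : nat) (g : 'I_m -> mpoly n R).

(** Only the products are prescribed: a coordinate of [z] whose [g j] vanishes at [x] stays free, so
    the solution set need not be a single point. *)
Definition resolved (x : 'rV[R]_n) (z : 'rV[R]_m) : Prop :=
  forall j, polyval (g j) x * z ord0 j = (0 < polyval (g j) x)%R%:R.

(** [h] may be discontinuous, since agreement with a polynomial is asked on resolved pairs only.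
    Such functions form an algebra containing the polynomials and the sign indicators. *)
Definition represented (h : 'rV[R]_n -> R) : Prop :=
  exists P : mpoly (n + m) R, forall x z, resolved x z -> polyval2 P x z = h x.

Lemma represented_sign j : represented (fun x => (0 < polyval (g j) x)%R%:R).
Proof.
have [P PE] : polyfun (fun w : 'rV[R]_(n + m) =>
    polyval (g j) (lsubmx w) * rsubmx w ord0 j).
  by apply: polyfunM; [apply: polyfun_comp|apply: polymap_coord]; solve_polymap.
by exists P => x z xz; rewrite /polyval2 PE row_mxKl row_mxKr.
Qed.

Lemma represented_polyval (p : mpoly n R) : represented (polyval p).
Proof.
have [P PE] : polyfun (fun w : 'rV[R]_(n + m) => polyval p (lsubmx w)).
  by apply: polyfun_comp; solve_polymap.
by exists P => x z _; rewrite /polyval2 PE row_mxKl.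
Qed.

Lemma represented_cst (c : R) : represented (fun=> c).
Proof. by exists (mpolyC _ c) => x z _; rewrite /polyval2 /polyval mevalC. Qed.

Lemma representedD h1 h2 :
  represented h1 -> represented h2 -> represented (fun x => h1 x + h2 x).
Proof.
move=> [P PE] [Q QE]; exists (P + Q) => x z xz.
by rewrite -(PE x z xz) -(QE x z xz) /polyval2 /polyval mevalD.
Qed.

Lemma representedM h1 h2 :
  represented h1 -> represented h2 -> represented (fun x => h1 x * h2 x).
Proof.
move=> [P PE] [Q QE]; exists (P * Q) => x z xz.
by rewrite -(PE x z xz) -(QE x z xz) /polyval2 /polyval mevalM.
Qed.

Lemma represented_compl h : represented h -> represented (fun x => 1 - h x).
Proof.
move=> [P PE]; exists (1 - P) => x z xz.
by rewrite -(PE x z xz) /polyval2 /polyval mevalB meval1.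
Qed.

Lemma represented_sum (I : Type) (r : seq I) (h : I -> 'rV[R]_n -> R) :
  (forall i, represented (h i)) -> represented (fun x => \sum_(i <- r) h i x).
Proof.
move=> hP; elim: r => [|i r IH].
  by under eq_fun do rewrite big_nil; apply: represented_cst.
by under eq_fun do rewrite big_cons; apply: representedD.
Qed.

Lemma represented_prod (I : eqType) (r : seq I) (h : I -> 'rV[R]_n -> R) :
  {in r, forall i, represented (h i)} ->
  represented (fun x => \prod_(i <- r) h i x).
Proof.
elim: r => [|i r IH] hP.
  by under eq_fun do rewrite big_nil; apply: represented_cst.
under eq_fun do rewrite big_cons.
apply: representedM; first by apply: hP; rewrite mem_head.
by apply: IH => k kr; apply: hP; rewrite inE kr orbT.
Qed.

Lemma prod_natr_all (I : Type) (r : seq I) (b : pred I) :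
  \prod_(i <- r) (b i)%:R = (all b r)%:R :> R.
Proof.
elim: r => [|i r IH]; first by rewrite big_nil.
by rewrite big_cons IH -natrM mulnb.
Qed.

(** The equation p = 0 has indicator 1 - [p^2 > 0], so only signs of strict positivity have to be
    detected, namely those of p^2 and of the inequalities. *)
Lemma represented_basic (c : mpoly n R * seq (mpoly n R)) :
  (forall p, p \in c.1 ^+ 2 :: c.2 -> exists j, g j = p) ->
  represented (fun x => (x \in basic_semialgebraic c)%:R).
Proof.
move=> cg; have -> : (fun x => (x \in basic_semialgebraic c)%:R) =
    (fun x => (1 - (0 < polyval (c.1 ^+ 2) x)%R%:R) *
              \prod_(q <- c.2) (0 < polyval q x)%R%:R) :> (_ -> R).
  apply: funext => x; rewrite prod_natr_all [X in 0 < X]rmorphXn /=.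
  rewrite exprn_even_gt0//= -[meval _ _]/(polyval c.1 x).
  have [c1|c1] := eqVneq (polyval c.1 x) 0; rewrite /= ?subrr ?mul0r ?subr0 ?mul1r.
    congr (_%:R); congr nat_of_bool; apply/idP/allP => [/set_mem[_ c2] //|c2].
    by apply/mem_set; split.
  by rewrite memNset// => -[/eqP]; rewrite (negbTE c1).
have sign_g p : p \in c.1 ^+ 2 :: c.2 -> represented (fun x => (0 < polyval p x)%R%:R).
  by move=> /cg[j <-]; apply: represented_sign.
apply: representedM; first by apply/represented_compl/sign_g/mem_head.
by apply: represented_prod => q qc; apply: sign_g; rewrite inE qc orbT.
Qed.

(** Inclusion-exclusion in product form: the complement of a union has as indicator the product of
    the complementary indicators. *)
Lemma represented_bigcup (cs : seq (mpoly n R * seq (mpoly n R))) :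
  (forall c, c \in cs ->
     forall p, p \in c.1 ^+ 2 :: c.2 -> exists j, g j = p) ->
  represented
    (fun x => (x \in \bigcup_(c in [set` cs]) basic_semialgebraic c)%:R).
Proof.
move=> csg; have -> :
    (fun x => (x \in \bigcup_(c in [set` cs]) basic_semialgebraic c)%:R) =
    (fun x => 1 - \prod_(c <- cs) (1 - (x \in basic_semialgebraic c)%:R))
    :> (_ -> R).
  apply: funext => x.
  under eq_bigr => c _.
    have -> : 1 - (x \in basic_semialgebraic c)%:R =
        (x \notin basic_semialgebraic c)%:R :> R.
      by case: (_ \in _); rewrite ?subrr ?subr0.
    over.
  rewrite (prod_natr_all cs (fun c => x \notin basic_semialgebraic c)).
  have -> : all (fun c => x \notin basic_semialgebraic c) cs =
      (x \notin \bigcup_(c in [set` cs]) basic_semialgebraic c).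
    apply/allP/idP => [ncs|/negP ncs c cP]; apply/negP.
      by move=> /set_mem[c /= /ncs/negP nc] xc; apply/nc/mem_set.
    by move=> /set_mem xc; apply/ncs/mem_set; exists c.
  by case: (_ \in _); rewrite ?subr0 ?subrr.
apply/represented_compl/represented_prod => c /csg cg.
exact/represented_compl/represented_basic.
Qed.

(* The minimum over [z_j >= 0] of [(1 - g_j z_j)^2] is [0], attained at
   [z_j = 1 / g_j] only, when [g_j > 0]; otherwise it is [1], attained exactly
   when [g_j z_j = 0]. *)
Definition detector (x : 'rV[R]_n) (z : 'rV[R]_m) : R :=
  \sum_(j < m) (1 - polyval (g j) x * z ord0 j) ^+ 2.

Lemma detector_polynomial :
  exists Q : mpoly (n + m) R, forall x z, polyval2 Q x z = detector x z.
Proof.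
have [Q QE] : polyfun (fun w : 'rV[R]_(n + m) => detector (lsubmx w) (rsubmx w)).
  apply: polyfun_sum => j; apply: polyfunX; apply: polyfunB.
    exact: polyfun_cst.
  by apply: polyfunM; [apply: polyfun_comp|apply: polymap_coord]; solve_polymap.
by exists Q => x z; rewrite /polyval2 QE row_mxKl row_mxKr.
Qed.

(** The bound holds term by term, and equality of the sums forces equality in every term. The
    minimum thus counts the indices [j] with [g j] nonpositive at [x]. *)
Lemma detector_leif x (z : 'rV[R]_m) : (forall j, 0 <= z ord0 j) ->
  \sum_(j < m) (~~ (0 < polyval (g j) x)%R)%:R <= detector x z ?=
    iff [forall j, polyval (g j) x * z ord0 j == (0 < polyval (g j) x)%R%:R].
Proof.
move=> z0; apply: leif_sum => j _; have := z0 j.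
case: ltP => [_ _|gx zj] /=; split.
- exact: sqr_ge0.
- by rewrite eq_sym sqrf_eq0 subr_eq0 eq_sym.
- have : 0 <= - (polyval (g j) x * z ord0 j) by rewrite oppr_ge0 mulr_le0_ge0.
  (* With t = g_j(x) z_j <= 0, the claim is 1 <= (1 - t)^2. *)
  by nra.
- have t0 : polyval (g j) x * z ord0 j <= 0 by rewrite mulr_le0_ge0.
  apply/eqP/eqP => [E|->]; last by rewrite subr0 expr1n.
  by nra.
Qed.

Definition sign_solution (x : 'rV[R]_n) : 'rV[R]_m :=
  \row_j (if 0 < polyval (g j) x then (polyval (g j) x)^-1 else 0).

Lemma sign_solution_ge0 x j : 0 <= sign_solution x ord0 j.
Proof. by rewrite mxE; case: ifP => // gx; rewrite invr_ge0 ltW. Qed.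

Lemma resolved_sign_solution x : resolved x (sign_solution x).
Proof.
move=> j; rewrite mxE; case: ifP => [gx|_]; last by rewrite mulr0.
by rewrite divff ?gt_eqF.
Qed.

Definition orthant : set 'rV[R]_m := box (fun=> 0%E) (fun=> +oo%E).

Lemma orthantP z : orthant z <-> forall j, 0 <= z ord0 j.
Proof.
by split=> z0 j; have := z0 j; rewrite ?leey ?andbT lee_fin.
Qed.

(** [sign_solution] attains the lower bound of [detector_leif], so the minimizers are exactly the
    equality cases of that bound. *)
Lemma detector_argmin x :
  argmin_on orthant (detector x) = [set z | orthant z /\ resolved x z].
Proof.
have solP : [forall j, polyval (g j) x * sign_solution x ord0 j ==
    (0 < polyval (g j) x)%R%:R].
  by apply/forallP => j; rewrite resolved_sign_solution.
have sol_eq : detector x (sign_solution x) =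
    \sum_(j < m) (~~ (0 < polyval (g j) x)%R)%:R.
  apply/esym/eqP; rewrite (detector_leif x (sign_solution_ge0 x)).2.
  exact: solP.
apply/seteqP; split=> z /= [zY].
- have z0 := (orthantP z).1 zY; move=> /(_ (sign_solution x)) zmin; split=> // j.
  have /zmin : orthant (sign_solution x) by apply/orthantP/sign_solution_ge0.
  rewrite sol_eq (ge_leif (detector_leif x z0)) => /forallP/(_ j)/eqP; exact.
- have z0 := (orthantP z).1 zY; move=> zR; split=> // y /orthantP y0.
  have /eqP <- : \sum_(j < m) (~~ (0 < polyval (g j) x)%R)%:R == detector x z.
    by rewrite (detector_leif x z0).2; apply/forallP => j; apply/eqP.
  exact: (detector_leif x y0).1.
Qed.

Lemma detector_convex x :
  @convex_function R 'rV[R]_m setT (detector x).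
Proof.
move=> t y z _ _; rewrite convRE [conv t y z]/conv /=.
have : 0 <= t%:num by []. have : t%:num <= 1 by [].
move: (t%:num) => /= s s1 s0; rewrite !mulr_sumr -big_split /=.
apply: ler_sum => j _; rewrite !mxE /unstable.onem; move: (polyval _ _) => c.
(* The convexity gap of the square of an affine function is s (1 - s) times the squared difference
   of its linear parts. *)
rewrite -subr_ge0 (_ : _ - _ = s * (1 - s) * (c * (y ord0 j - z ord0 j)) ^+ 2).
  by rewrite mulr_ge0 ?sqr_ge0// mulr_ge0 ?subr_ge0.
ring.
Qed.

End SignDetection.

(** The upper-level values over the solution set form a singleton, so one construction serves the
    infimum and the supremum; it also records that the solution set is nonempty. *)
Lemma PP_value_function (R : realType) (n : nat) (f : 'rV[R]_n -> R) :
  piecewise_polynomial f ->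
  exists (m : nat) (P Q : mpoly (n + m) R) (a b : 'I_m -> \bar R),
    [/\ convex_lower Q, unbounded_box a b &
        forall x, [set (polyval2 P x y)%:E | y in Theta Q (box a b) x] =
                  [set (f x)%:E]].
Proof.
move=> [N [S [p [/choice[cs csE] Sdisj Scover fE]]]].
(* The leading [0] ensures that the box has dimension at least one. *)
pose gs := 0 :: flatten [seq c.1 ^+ 2 :: c.2 | c <-
     flatten [seq cs i | i <- enum 'I_N]].
pose g (j : 'I_(size gs)) := gs`_j.
have [Q QE] := detector_polynomial g.
have gsP i c q : c \in cs i -> q \in c.1 ^+ 2 :: c.2 -> exists j, g j = q.
  move=> ci qc; have qgs : q \in gs.
    rewrite inE; apply/orP; right; apply/flatten_mapP; exists c => //.
    by apply/flatten_mapP; exists i => //; rewrite mem_enum.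
  have qlt : (index q gs < size gs)%N by rewrite index_mem.
  by exists (Ordinal qlt); rewrite /g /= nth_index.
have [P PE] : represented g (fun x => \sum_(i < N) (x \in S i)%:R * polyval (p i) x).
  apply: represented_sum => i; apply: representedM; last exact: represented_polyval.
  by rewrite csE; apply: represented_bigcup => c ci q; apply: gsP ci.
exists (size gs), P, Q, (fun=> 0%E), (fun=> +oo%E); split.
- by move=> x; rewrite (funext (QE x)); apply: detector_convex.
- by exists ord0; right.
(* Since the pieces partition the space, exactly one indicator equals 1 at [x]. *)
move=> x; have fxE : f x = \sum_(i < N) (x \in S i)%:R * polyval (p i) x.
  have : (\bigcup_i S i) x by rewrite Scover.
  move=> [i _ xi]; rewrite (bigD1 i)//= mem_set// mul1r -fE// big1 ?addr0// => j ji.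
  rewrite memNset ?mul0r// => xj; case/eqP: ji.
  by apply: Sdisj => //; exists x.
have -> : Theta Q (box (fun=> 0%E) (fun=> +oo%E)) x =
    [set z | @orthant R (size gs) z /\ resolved g x z].
  by rewrite -detector_argmin /Theta (funext (QE x)).
(* One inclusion says that [P] is constant on the solution set, the other that this set contains
   [sign_solution]. *)
apply/seteqP; split=> [_ [z [_ zx] <-]|_ ->] /=; first by rewrite PE// -fxE.
exists (sign_solution g x); last by rewrite PE -?fxE//; apply: resolved_sign_solution.
by split; [apply/orthantP/sign_solution_ge0|apply: resolved_sign_solution].
Qed.

Theorem theorem2p18 (R : realType) (n : nat) :
  [/\ PP R n `<=` C_optim_unbound R n,
      C_optim_unbound R n `<=` SA R n,
      PP R n `<=` C_pessim_unbound R n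
    & C_pessim_unbound R n `<=` SA R n].
Proof.
split.
- move=> _ [f /PP_value_function[m [P [Q [a [b [cQ ub E]]]]]] ->].
  exists m, P, Q, a, b; split=> //; apply: funext => x.
  by rewrite /phi_o E ereal_inf1.
- move=> _ [m [P [Q [a [b [_ _ <-]]]]]].
  exact/SA_phi_o/semialgebraic_box.
- move=> _ [f /PP_value_function[m [P [Q [a [b [cQ ub E]]]]]] ->].
  exists m, P, Q, a, b; split=> //; apply: funext => x.
  by rewrite /phi_p E ereal_sup1.
- move=> _ [m [P [Q [a [b [_ _ <-]]]]]].
  exact/SA_phi_p/semialgebraic_box.
Qed.
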